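(* Let $n\in\mathbb{N}$, $n\ge 1$. For $i=1,\ldots,n$ let $T_i$ be a contraction on a complex Hilbert space $\mathbb{H}_i$ with $\mathbb{T}\subseteq\sigma(T_i)$. For $i=1,\ldots,n$ define the operator on $\mathbb{H}_1\otimes\cdots\otimes\mathbb{H}_n$ $$\tilde{T}_i=T_1\otimes\cdots\otimes T_i\otimes I_{\mathbb{H}_{i+1}\otimes\cdots\otimes\mathbb{H}_n}$$ (so $\tilde T_n=T_1\otimes\cdots\otimes T_n$). Then the function $g_{\boldsymbol{T}}:\ell^1(n)\to\mathcal{B}(\mathbb{H}_1\otimes\cdots\otimes\mathbb{H}_n)$ defined by $$g_{\boldsymbol{T}}(a_1,\ldots,a_n)=a_1\tilde{T}_1+\cdots+a_n\tilde{T}_n$$ is an isometry.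
   Context: $\ell^1(n)$ denotes $\mathbb{C}^n$ with the norm $\|(a_1,\ldots,a_n)\|_1=\sum_{i=1}^n|a_i|$. $\mathbb{T}$ is the unit circle in $\mathbb{C}$; $\sigma(T)$ is the spectrum of a bounded operator $T$; a contraction is a bounded linear operator of norm at most $1$. $\mathcal{B}(\mathbb{H})$ is the space of bounded operators on $\mathbb{H}$ with the operator norm, and $\otimes$ denotes the Hilbert space tensor product (and the corresponding tensor product of bounded operators). *)

(* Defs.v *)
From HB Require Import structures.
From mathcomp Require Import all_boot all_order all_algebra sesquilinear.
From mathcomp Require Import complex.
From mathcomp Require Import all_classical all_reals topology normedtype.

Set Implicit Arguments.
Unset Strict Implicit.
Unset Printing Implicit Defensive.

Import Order.TTheory GRing.Theory Num.Theory.
Import numFieldNormedType.Exports.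

Local Open Scope classical_set_scope.
Local Open Scope ring_scope.
Local Open Scope complex_scope.

(* Complex Hilbert spaces: the inner product is linear in its first argument
   and conjugate-linear in its second one. *)
HB.mixin Record CompleteNormedModule_isHilbert (R : realType) V
    & CompleteNormedModule R[i] V := {
  inner : {dot V for (@Num.conj R[i])} ;
  inner_normE : forall x : V, `|x| ^+ 2 = inner x x
}.

#[short(type="hilbertType")]
HB.structure Definition Hilbert (R : realType) :=
  {V of CompleteNormedModule R[i] V & CompleteNormedModule_isHilbert R V}.

Section BoundedOperators.
Context (R : realType) (V : normedModType R[i]).
Implicit Types f g : V -> V.

Let cD (a b : R) : (a + b)%:C = a%:C + b%:C. Proof. exact: rmorphD. Qed.

Let cM (a b : R) : (a * b)%:C = a%:C * b%:C. Proof. exact: rmorphM. Qed.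

Let cRe (z : R[i]) : 0 <= z -> (complex.Re z)%:C = z.
Proof. by move=> z0; rewrite RRe_real ?ger0_real. Qed.

Definition bounded_linear : {pred V -> V} :=
  mem [set f | linear f /\
               exists M : R, forall x : V, `|f x| <= M%:C * `|x|].

Record bop := BOp { bop_fun :> V -> V ; _ : bop_fun \in bounded_linear }.

HB.instance Definition _ := [isSub for bop_fun].
HB.instance Definition _ := gen_eqMixin bop.
HB.instance Definition _ := [Choice of bop by <:].

Lemma bounded_linear_submod_closed : submod_closed bounded_linear.
Proof.
split=> [|a f g].
  rewrite inE; split=> [c x y|]; first by rewrite [RHS]addr0 scaler0.
  by exists 0 => x; rewrite [X in `|X|](_ : _ = 0)// normr0 mul0r.
rewrite !inE => -[lf [M Mf]] [lg [N Ng]]; split.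
  have E z : (a *: f + g) z = a *: f z + g z by [].
  by move=> c x y; rewrite !E lf lg !scalerDr !scalerA [a * c]mulrC addrACA.
exists (complex.Re `|a| * M + N) => x; apply: le_trans (ler_normD _ _) _.
rewrite cD cM cRe// mulrDl lerD//.
by rewrite normrZ -mulrA ler_wpM2l.
Qed.

HB.instance Definition _ :=
  GRing.isSubmodClosed.Build _ _ bounded_linear bounded_linear_submod_closed.
HB.instance Definition _ := [SubChoice_isSubLmodule of bop by <:].

Lemma bop_linear (T : bop) : linear T.
Proof. by case: T => f /= /[!inE] -[]. Qed.

HB.instance Definition _ (T : bop) :=
  GRing.isLinear.Build R[i] V V *:%R T (bop_linear T).

Lemma bop_bounded (T : bop) : exists M : R, forall x, `|T x| <= M%:C * `|x|.
Proof. by case: T => f /= /[!inE] -[]. Qed.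

Lemma bopP (S T : bop) : S = T <-> S =1 T.
Proof. by split=> [->//|ST]; exact/val_inj/funext. Qed.

Lemma bop_add (S T : bop) x : (S + T) x = S x + T x. Proof. by []. Qed.

Lemma bop_scale (a : R[i]) (T : bop) x : (a *: T) x = a *: T x.
Proof. by []. Qed.

(* Norms of normed modules over R[i] take their values in R[i]; complex.Re
   brings them back to R, where suprema exist. *)
Definition opnorm (T : bop) : R :=
  sup [set complex.Re `|T x| | x in [set x : V | `|x| <= 1]].

Let Re_norm (x : V) : (complex.Re `|x|)%:C = `|x|.
Proof. exact: cRe. Qed.

Let opnorm_has_sup (T : bop) :
  has_sup [set complex.Re `|T x| | x in [set x : V | `|x| <= 1]].
Proof.
split; first by exists (complex.Re `|T 0|), 0; rewrite //= normr0 ler01.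
have [M MT] := bop_bounded T.
exists `|M| => _ [x x1 <-]; rewrite -lecR Re_norm (le_trans (MT x))//.
rewrite (@le_trans _ _ (`|M|%:C * `|x|))//; last by rewrite ler_piMr// ler0c.
by rewrite ler_wpM2r// lecR ler_norm.
Qed.

Lemma opnorm_ge0 (T : bop) : 0 <= opnorm T.
Proof.
apply: (le_trans (y := complex.Re `|T 0|)).
  by rewrite -ler0c Re_norm.
apply: (sup_upper_bound (opnorm_has_sup T)).
by exists 0; rewrite //= normr0 ler01.
Qed.

Lemma opnorm_ub (T : bop) x : `|T x| <= (opnorm T)%:C * `|x|.
Proof.
have [->|x0] := eqVneq x 0; first by rewrite linear0 normr0 mulr0.
rewrite -ler_pdivrMr ?normr_gt0// mulrC.
have -> : `|x|^-1 * `|T x| = `|T (`|x|^-1 *: x)|.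
  by rewrite linearZ normrZ normfV normr_id.
rewrite -Re_norm lecR; apply: (sup_upper_bound (opnorm_has_sup T)).
exists (`|x|^-1 *: x) => //=.
by rewrite normrZ normfV normr_id mulVf ?normr_eq0.
Qed.

Lemma opnorm_le (T : bop) (M : R) :
  0 <= M -> (forall x, `|T x| <= M%:C * `|x|) -> opnorm T <= M.
Proof.
move=> M0 MT; apply: ge_sup; first by case: (opnorm_has_sup T).
move=> _ [x x1 <-]; rewrite -lecR Re_norm (le_trans (MT x))//.
by rewrite ler_piMr// ler0c.
Qed.

Let bop_norm (T : bop) : R[i] := (opnorm T)%:C.

Let bop_normD (S T : bop) : bop_norm (S + T) <= bop_norm S + bop_norm T.
Proof.
rewrite /bop_norm -cD lecR opnorm_le ?addr_ge0 ?opnorm_ge0// => x.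
rewrite bop_add (le_trans (ler_normD _ _))// cD mulrDl.
by rewrite lerD// opnorm_ub.
Qed.

Let bop_normZ_le (a : R[i]) (T : bop) : bop_norm (a *: T) <= `|a| * bop_norm T.
Proof.
rewrite /bop_norm -[`|a|]cRe// -cM lecR.
have a0 : 0 <= complex.Re `|a| by rewrite -ler0c cRe.
rewrite opnorm_le ?mulr_ge0 ?opnorm_ge0// => x.
rewrite bop_scale normrZ cM cRe// -mulrA.
by rewrite ler_wpM2l// opnorm_ub.
Qed.

Let bop_normZ (a : R[i]) (T : bop) : bop_norm (a *: T) = `|a| * bop_norm T.
Proof.
apply/le_anti; rewrite bop_normZ_le /=.
have [->|a0] := eqVneq a 0; first by rewrite normr0 mul0r ler0c opnorm_ge0.
rewrite -[in X in X <= _](scalerK a0 T) -ler_pdivlMl ?normr_gt0//.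
by rewrite -normfV bop_normZ_le.
Qed.

Let bop_norm0_eq0 (T : bop) : bop_norm T = 0 -> T = 0.
Proof.
move=> T0; apply/bopP => x; apply/eqP.
by rewrite -normr_le0 (le_trans (opnorm_ub T x))// -/(bop_norm T) T0 mul0r.
Qed.

HB.instance Definition _ :=
  Lmodule_isNormed.Build R[i] bop bop_normD bop_normZ bop_norm0_eq0.

Lemma bop_normE (T : bop) : `|T| = (opnorm T)%:C. Proof. by []. Qed.

Lemma bounded_linear_id : @idfun V \in bounded_linear.
Proof. by rewrite inE; split=> //; exists 1 => x; rewrite mul1r. Qed.

Definition bop_id : bop := BOp bounded_linear_id.

Definition bop_invertible (T : bop) : Prop :=
  exists S : bop, cancel T S /\ cancel S T.

Definition spectrum (T : bop) : set R[i] :=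
  [set l | ~ bop_invertible (T - l *: bop_id)].

Definition bop_contraction (T : bop) : Prop := `|T| <= 1.

End BoundedOperators.
Arguments bop {R} V.
Arguments bop_id {R V}.

(* l^1(n), with a separate name as 'rV_n itself carries the sup norm. *)
Definition l1 (R : realType) (n : nat) : Type := 'rV[R[i]]_n.

Section L1.
Context (R : realType) (n : nat).

HB.instance Definition _ := GRing.Lmodule.on (l1 R n).

Let l1_norm (a : l1 R n) : R[i] := \sum_(i < n) `|(a : 'rV_n) 0 i|.

Let l1_normD (a b : l1 R n) : l1_norm (a + b) <= l1_norm a + l1_norm b.
Proof.
by rewrite -big_split ler_sum// => i _; rewrite mxE ler_normD.
Qed.

Let l1_normZ (c : R[i]) (a : l1 R n) : l1_norm (c *: a) = `|c| * l1_norm a.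
Proof. by rewrite mulr_sumr; apply: eq_bigr => i _; rewrite mxE normrM. Qed.

Let l1_norm0_eq0 (a : l1 R n) : l1_norm a = 0 -> a = 0.
Proof.
move/eqP; rewrite psumr_eq0// => /allP a0; apply/rowP => i; rewrite mxE.
by apply/eqP; rewrite -normr_eq0 (implyP (a0 i _))// mem_index_enum.
Qed.

HB.instance Definition _ :=
  Lmodule_isNormed.Build R[i] (l1 R n) l1_normD l1_normZ l1_norm0_eq0.

Lemma l1_normE (a : l1 R n) : `|a| = \sum_(i < n) `|(a : 'rV_n) 0 i|.
Proof. by []. Qed.

End L1.

(* A realization of the Hilbert space tensor product of the family H: the
   Hilbert space completion of the algebraic tensor product for the inner
   product determined by <x1 (x) .. (x) xn, y1 (x) .. (x) yn> = \prod_i <xi, yi>.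
   It is unique up to a unitary isomorphism preserving elementary tensors. *)
Record hilbert_tensor (R : realType) (n : nat) (H : 'I_n -> hilbertType R) := {
  tensor_space :> hilbertType R ;
  tensor : (forall i, H i) -> tensor_space ;
  tensor_linear : forall (x : forall i, H i) (i : 'I_n),
    linear (fun u : H i => tensor (eqtype.dfwith x u)) ;
  tensor_inner : forall x y : forall i, H i,
    inner (tensor x) (tensor y) = \prod_(i < n) inner (x i) (y i) ;
  tensor_total : dense [set z : tensor_space |
    exists (k : nat) (c : 'I_k -> R[i]) (x : 'I_k -> forall i, H i),
      z = \sum_(j < k) c j *: tensor (x j)]
}.
Arguments tensor {R n H} h x.

Section TensorOperators.
Context (R : realType) (n : nat) (H : 'I_n -> hilbertType R).
Variable (HT : hilbert_tensor H).

Definition is_tensor_op (T : forall i, bop (H i)) (S : bop HT) : Prop :=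
  forall x : forall i, H i, S (tensor HT x) = tensor HT (fun i => T i (x i)).

Lemma is_tensor_op_unique (T : forall i, bop (H i)) (S S' : bop HT) :
  is_tensor_op T S -> is_tensor_op T S' -> S = S'.
Proof.
move=> ST S'T; apply/bopP => z; apply: contrapT => /eqP.
rewrite -subr_eq0 -normr_gt0 => Dz; pose K := (opnorm (S - S'))%:C + 1.
have D_tensor k (c : 'I_k -> R[i]) (x : 'I_k -> forall i, H i) :
    let w := \sum_(j < k) c j *: tensor HT (x j) in S w = S' w.
  by rewrite /= !linear_sum; apply: eq_bigr => j _; rewrite !linearZ /= ST S'T.
have K0 : 0 < K by rewrite ltr_wpDl// ler0c opnorm_ge0.
have e0 : 0 < `|S z - S' z| / K by rewrite divr_gt0.
have [||w [zw [k [c [x wE]]]]] :=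
  tensor_total (h := HT) (O := ball z (`|S z - S' z| / K)).
- by exists z; exact: ballxx.
- exact: ball_open.
have Ew : S z - S' z = (S - S') (z - w).
  rewrite [RHS]linearB -[RHS]/((S z - S' z) - (S w - S' w)).
  by rewrite wE D_tensor subrr subr0.
move: zw; rewrite -ball_normE /= ltr_pdivlMr// => zw.
suff : `|S z - S' z| < `|S z - S' z| by rewrite ltxx.
apply: le_lt_trans zw; rewrite {1}Ew mulrC.
by apply: le_trans (opnorm_ub _ _) _; rewrite ler_wpM2r// lerDl.
Qed.

(* The tensor product of bounded operators is the unique bounded operator
   acting factorwise on elementary tensors; the default value 0 of xget is
   immaterial, as such an operator always exists. *)
Definition tensor_op (T : forall i, bop (H i)) : bop HT :=
  xget 0 [set S | is_tensor_op T S].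

(* The identity of H_{i+1} (x) .. (x) H_n is read as the tensor product of the
   identities of its factors. *)
Definition tensor_tilde (T : forall i, bop (H i)) (i : 'I_n) : bop HT :=
  tensor_op (fun j => if (j <= i)%N then T j else bop_id).

Definition g_op (T : forall i, bop (H i)) (a : l1 R n) : bop HT :=
  \sum_(i < n) (a : 'rV_n) 0 i *: tensor_tilde T i.

End TensorOperators.

Definition is_isometry (R : realType) (V W : normedModType R[i])
  (f : V -> W) : Prop := forall a b : V, `|f a - f b| = `|a - b|.

(* Main.v *)
Require Import Defs.
From mathcomp Require Import all_boot all_order all_algebra complex.
From mathcomp Require Import all_classical all_reals topology normedtype.
From mathcomp Require Import sesquilinear spectral ring.
Import Order.TTheory GRing.Theory Num.Theory.
Import numFieldNormedType.Exports.
Local Open Scope classical_set_scope.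
Local Open Scope ring_scope.

(** The map is linear, so it is an isometry as soon as it preserves norms.

    The upper bound is the triangle inequality together with the fact that a
    tensor product of contractions exists and is a contraction
    ([tensor_op_contraction]).  On a finite combination [\sum_j c_j x_j] of
    elementary tensors, the squared norm is the value at [c] of the pointwise
    product of the Gram kernels of the factors.  Applying a contraction to one
    factor decreases its Gram kernel in the positive semidefinite order, and
    the Schur product theorem carries this over to the pointwise product
    ([psd_kernel_prod_le]).  The resulting inequality makes the operator well
    defined and contractive on the span of the elementary tensors, and
    completeness extends it to the whole space ([bounded_extension]).

    For the lower bound, choose unimodular [l_1, ..., l_n] such that
    [a_i l_1 ... l_i = |a_i|] for all [i] ([cumulative_phases]).  A unimodular
    point of the spectrum of a contraction is an approximate eigenvalue
    ([approximate_eigenvector]), hence there are unit vectors [x_i] with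
    [<T_i x_i, x_i>] close to [l_i].  For the unit vector
    [X = x_1 (x) ... (x) x_n], the number [<g(a) X, X>] is the sum of the
    [a_i <T_1 x_1, x_1> ... <T_i x_i, x_i>], which is close to
    [\sum_i |a_i|], and it is at most the norm of [g(a)] in modulus. *)

(** * Extension by continuity *)

Section Extension.
Context {R : realType} {V : completeNormedModType R[i]}.
Variables (G : V -> V -> Prop) (M : R[i]).
Hypothesis G_linear : forall a z w z' w',
  G z w -> G z' w' -> G (a *: z + z') (a *: w + w').
Hypothesis M_ge0 : 0 <= M.
Hypothesis G_bound : forall z w, G z w -> `|w| <= M * `|z|.
Hypothesis G_dense : forall z (e : R[i]), 0 < e ->
  exists z' w', G z' w' /\ `|z - z'| < e.

(** The closure of the graph [G]: boundedness turns it into the graph of a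
    function, and completeness makes this function total. *)
Let Gbar z w := forall e : R[i], 0 < e ->
  exists z' w', [/\ G z' w', `|z - z'| < e & `|w - w'| < e].

Let G_Gbar z w : G z w -> Gbar z w.
Proof. by move=> Gzw e e0; exists z, w; rewrite !subrr !normr0. Qed.

Let Gbar_linear a z w z' w' :
  Gbar z w -> Gbar z' w' -> Gbar (a *: z + z') (a *: w + w').
Proof.
move=> Gz Gz' e e0; have a0 : 0 < `|a| + 2 by rewrite ltr_wpDl.
have [d d0 ed] : exists2 d, 0 < d & e = `|a| * d + (d + d).
  exists (e / (`|a| + 2)); first exact: divr_gt0.
  by rewrite -[LHS](divfK (lt0r_neq0 a0)) mulrC mulrDl mulr_natl mulr2n.
have [z1 [w1 [G1 zz1 ww1]]] := Gz _ d0.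
have [z2 [w2 [G2 zz2 ww2]]] := Gz' _ d0.
have comb x y : `|x| < d -> `|y| < d -> `|a *: x + y| < e.
  move=> xd yd; rewrite (le_lt_trans (ler_normD _ _))// normrZ ed.
  by rewrite ler_ltD ?ler_wpM2l// ?ltW// ltr_wpDr// ltW.
exists (a *: z1 + z2), (a *: w1 + w2); split; first exact: G_linear.
all: by rewrite opprD addrACA -scalerBr; exact: comb.
Qed.

Let Gbar_bound z w : Gbar z w -> `|w| <= M * `|z|.
Proof.
move=> Gzw; apply/ler_addgt0Pr => e e0.
have M0 : 0 < M + 1 by rewrite ltr_wpDl.
have [d d0 ed] : exists2 d, 0 < d & e = M * d + d.
  exists (e / (M + 1)); first exact: divr_gt0.
  by rewrite -[LHS](divfK (lt0r_neq0 M0)) mulrC mulrDl mul1r.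
have [z' [w' [G' zz' ww']]] := Gzw _ d0.
rewrite -[w](subrK w') addrC (le_trans (ler_normD _ _))//.
rewrite ed addrA lerD ?(ltW ww')//.
rewrite (le_trans (G_bound _ _ G'))// -mulrDr ler_wpM2l//.
rewrite -[z' in leLHS](subKr z) (le_trans (ler_normB _ _))// lerD2l.
exact: ltW.
Qed.

Let Gbar_unique z w w' : Gbar z w -> Gbar z w' -> w = w'.
Proof.
move=> Gw Gw'; apply/eqP; rewrite eq_sym -subr_eq0 -normr_le0.
have := Gbar_bound _ _ (Gbar_linear (-1) _ _ _ _ Gw Gw').
by rewrite !scaleN1r addNr normr0 mulr0 addrC.
Qed.

Let Gbar_total z : exists w, Gbar z w.
Proof.
(* The values of G near z form a Cauchy filter; its limit is the value of the
   extension at z. *)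
pose F := filter_from [set e : R[i] | 0 < e]
  (fun e => [set w | exists z', G z' w /\ `|z - z'| < e]).
have FF : ProperFilter F.
  apply: filter_from_proper; last first.
    by move=> e e0; have [z' [w ?]] := G_dense z _ e0; exists w, z'.
  (* Two radii are comparable although the scalars are only partially
     ordered, since both are positive. *)
  apply: filter_from_filter; first by exists 1; rewrite /= ltr01.
  move=> e e' /= e0 e'0.
  have ee' : e >=< e' by rewrite real_comparable ?gtr0_real.
  exists (Num.min e e'); first by rewrite /= comparable_lt_min// e0.
  move=> w [z' [G' zz']].
  by move: zz'; rewrite comparable_lt_min// => /andP[? ?]; split; exists z'.
have /cauchy_cvg/cvg_ex[/= w Fw] : cauchy F.
  apply: cauchy_exP => e e0.
  have M0 : 0 < M + 1 by rewrite ltr_wpDl.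
  have d0 : 0 < e / (M + 1) / 2 by rewrite !divr_gt0.
  have [z0 [w0 [G0 zz0]]] := G_dense z _ d0.
  exists w0, (e / (M + 1) / 2) => // w [z' [G' zz']].
  rewrite -ball_normE/=.
  have := G_bound _ _ (G_linear (-1) _ _ _ _ G' G0).
  rewrite !scaleN1r addrC => /le_lt_trans; apply.
  have zz : `|- z' + z0| <= e / (M + 1).
    rewrite addrC (le_trans (ler_distD z _ _))// [leRHS]splitr.
    by rewrite lerD// ltW// distrC.
  rewrite (le_lt_trans (ler_wpM2l M_ge0 zz))// mulrCA -ltr_pdivlMl//.
  rewrite mulVf ?gt_eqF//.
  by rewrite ltr_pdivrMr// mul1r ltrDl.
exists w => e e0.
have /Fw Fb : nbhs w (ball w e) by exact: nbhsx_ballx.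
have Fe : F [set w | exists z', G z' w /\ `|z - z'| < e] by exists e.
have [w' [+ [z' [G' zz']]]] := filter_ex (filterI Fb Fe).
by rewrite -ball_normE /= => ww'; exists z', w'.
Qed.

(** The operator is given by a relation rather than by a function on a subspace:
    the bound on [G] forces single-valuedness, so that an operator can be
    prescribed on vectors that have many different representations. *)
Lemma bounded_extension : exists S : bop V,
  (forall z w, G z w -> S z = w) /\ (forall z, `|S z| <= M * `|z|).
Proof.
have [f fP] := choice Gbar_total.
have lf : linear f.
  by move=> a x y; apply: Gbar_unique (fP _) _; exact: Gbar_linear.
have bf : f \in @bounded_linear R V.
  rewrite inE; split=> //; exists (complex.Re M) => x.
  by rewrite RRe_real ?ger0_real//; exact: Gbar_bound.
exists (BOp bf); split=> [z w Gzw|z] /=; last exact: Gbar_bound.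
exact: Gbar_unique (fP _) (G_Gbar _ _ Gzw).
Qed.

End Extension.

(** * Unimodular spectral points of contractions *)

(** The inverse is the extension by continuity of the relation [A w |-> w],
    which is bounded by [c^-1] on the dense range of [A]. *)
Lemma bop_invertible_bounded_below {R : realType}
    {V : completeNormedModType R[i]} (A : bop V) (c : R[i]) :
    0 < c -> (forall x, c * `|x| <= `|A x|) ->
    (forall y (e : R[i]), 0 < e -> exists x, `|y - A x| < e) ->
  bop_invertible A.
Proof.
move=> c0 A_below A_dense.
have [||||S [SA S_bd]] := @bounded_extension R V (fun z w => z = A w) c^-1.
- by move=> a z w z' w' -> ->; rewrite linearP.
- by rewrite invr_ge0 ltW.
- by move=> z w ->; rewrite ler_pdivlMl ?A_below.
- by move=> z e /(A_dense z)[x zx]; exists (A x), x.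
have ASK : cancel A S by move=> x; exact: SA.
exists S; split=> // y; apply/eqP; rewrite eq_sym -subr_eq0 -normr_le0.
have [N N0 AN] : exists2 N : R[i], 0 <= N & forall x, `|A x| <= N * `|x|.
  exists `|A| => // x; exact: opnorm_ub.
apply/ler_addgt0Pr => e e0; rewrite add0r.
have K0 : 0 < 1 + N / c by rewrite ltr_pwDl// divr_ge0// ltW.
have [x yx] := A_dense y _ (divr_gt0 e0 K0).
have -> : y - A (S y) = (y - A x) - A (S (y - A x)).
  have {1}-> : S y = x + S (y - A x) by rewrite linearB/= ASK addrC subrK.
  by rewrite linearD opprD addrA.
rewrite (le_trans (ler_normB _ _))// -[leRHS](divfK (lt0r_neq0 K0)).
rewrite mulrDr mulr1 lerD//; first exact: ltW.
rewrite (le_trans (AN _))// mulrCA ler_wpM2l//.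
rewrite (le_trans (S_bd _))// mulrC ler_wpM2r ?invr_ge0 ?(ltW c0)//.
exact: ltW.
Qed.

Lemma archi_complex {R : realType} (x : R[i]) : 0 <= x ->
  exists N : nat, x < N%:R.
Proof.
move=> x0; have := archi_boundP (x := complex.Re x).
rewrite -ler0c RRe_real ?ger0_real// => /(_ x0) xN.
exists (Num.bound (complex.Re x)).
rewrite -[x in ltLHS]RRe_real ?ger0_real//.
by rewrite -(rmorph_nat (real_complex R)) ltcR.
Qed.

Lemma contraction_le {R : realType} {V : normedModType R[i]} (T : bop V) x :
  bop_contraction T -> `|T x| <= `|x|.
Proof.
move=> T1; apply: (le_trans (opnorm_ub T x)); rewrite -bop_normE.
by rewrite ler_piMl.
Qed.

Section ApproximateEigenvectors.
Context {R : realType} {V : completeNormedModType R[i]}.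
Variables (T : bop V) (l : R[i]).
Hypothesis T_contraction : bop_contraction T.
Hypothesis l_unimodular : `|l| = 1.

Let A : bop V := T - l *: bop_id.

(** Here [s] is the ergodic sum [\sum_(k < N) l^-k T^k r] and
    [v = l^(1-N) T^N r].  Telescoping keeps [A s] bounded independently of
    [N], while [N r - s] lies in the range of [A] because each
    [r - l^-k T^k r] does. *)
Lemma ergodic_sum (r : V) (N : nat) : exists u s v,
  [/\ A u = N%:R *: r - s, A s = v - l *: r & `|v| <= `|r|].
Proof.
have l0 : l != 0 by rewrite -normr_eq0 l_unimodular oner_eq0.
elim: N => [|N [u [s [v [Au As vr]]]]].
  exists 0, 0, (l *: r); split.
  - by rewrite linear0 scale0r subrr.
  - by rewrite linear0 subrr.
  - by rewrite normrZ l_unimodular mul1r.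
exists (u - l^-1 *: s), (s + l^-1 *: v), (l^-1 *: T v); split.
- have -> : A (u - l^-1 *: s) = A u - l^-1 *: A s by rewrite linearB linearZ.
  rewrite Au As scalerBr scalerA mulVf// scale1r opprB addrACA.
  by rewrite -opprD -natr1 scalerDl scale1r.
- have -> : A (s + l^-1 *: v) = A s + l^-1 *: (T v - l *: v).
    by rewrite linearD linearZ.
  by rewrite As scalerBr scalerA mulVf// scale1r addrC subrKA.
- rewrite normrZ normfV l_unimodular invr1 mul1r.
  by rewrite (le_trans (contraction_le _ _ T_contraction)).
Qed.

(** Otherwise [A = T - l] is bounded below by [e], so the ergodic sums of
    [ergodic_sum], whose images under [A] are bounded, are bounded themselves.
    Dividing [N r - s] by [N] shows that [r] is a limit of elements of the range
    of [A]; this range is therefore dense and [A] is invertible. *)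
Lemma approximate_eigenvector (e : R[i]) : 0 < e -> spectrum T l ->
  exists x, `|x| = 1 /\ `|T x - l *: x| < e.
Proof.
move=> e0 Tl; apply: contrapT => noeig; apply: Tl.
have T_below x : e * `|x| <= `|A x|.
  have [->|x0] := eqVneq x 0; first by rewrite normr0 mulr0.
  have nx : 0 < `|x| by rewrite normr_gt0.
  rewrite -ler_pdivlMr// real_leNgt ?(gtr0_real e0) ?ger0_real ?divr_ge0//.
  apply/negP => xe; apply: noeig; exists (`|x|^-1 *: x); split.
    by rewrite normrZ normfV normr_id mulVf ?normr_eq0.
  rewrite linearZ/= scalerA [l * _]mulrC -scalerA -scalerBr normrZ normfV.
  by rewrite normr_id mulrC.
apply: (bop_invertible_bounded_below _ _ e0 T_below) => r d d0.
have [N rN] : exists N : nat, (2 * `|r|) / (e * d) < N.+1%:R.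
  have [|N rN] := @archi_complex _ ((2 * `|r|) / (e * d)).
    by rewrite divr_ge0 ?mulr_ge0// ltW.
  by exists N; rewrite (lt_trans rN)// ltr_nat.
have [u [s [v [Au As vr]]]] := ergodic_sum r N.+1.
have N0 : 0 < N.+1%:R :> R[i] by rewrite ltr0n.
exists (N.+1%:R^-1 *: u).
have -> : r - A (N.+1%:R^-1 *: u) = N.+1%:R^-1 *: s.
  have -> : A (N.+1%:R^-1 *: u) = N.+1%:R^-1 *: A u by rewrite linearZ.
  rewrite Au scalerBr scalerA mulVf ?gt_eqF//.
  by rewrite scale1r opprB addrC subrK.
rewrite normrZ normfV ger0_norm ?(ltW N0)// ltr_pdivrMl//.
have : e * `|s| <= 2 * `|r|.
  apply: (le_trans (T_below s)); rewrite As.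
  rewrite (le_trans (ler_normB _ _))// normrZ l_unimodular mul1r.
  by rewrite mulr_natl mulr2n lerD2r.
rewrite -ler_pdivlMl// => /le_lt_trans; apply.
move: rN; rewrite ltr_pdivrMr ?mulr_gt0//.
by rewrite ltr_pdivrMl// mulrCA.
Qed.

End ApproximateEigenvectors.

(** * Positive semidefinite kernels and the Schur product theorem *)

Definition psd_kernel {C : numClosedFieldType} {k : nat}
    (K : 'I_k -> 'I_k -> C) : Prop :=
  (forall j l, K j l = (K l j)^*) /\
  (forall c : 'I_k -> C, 0 <= \sum_j \sum_l c j * (c l)^* * K j l).

Section PsdKernels.
Context {C : numClosedFieldType} {k : nat}.
Implicit Types K L P Q : 'I_k -> 'I_k -> C.

Lemma psd_kernelD K L : psd_kernel K -> psd_kernel L ->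
  psd_kernel (fun j l => K j l + L j l).
Proof.
move=> [Kh K0] [Lh L0]; split=> [j l|c]; first by rewrite Kh Lh rmorphD.
have -> : \sum_j \sum_l c j * (c l)^* * (K j l + L j l) =
   \sum_j \sum_l c j * (c l)^* * K j l + \sum_j \sum_l c j * (c l)^* * L j l.
  rewrite -big_split; apply: eq_bigr => j _; rewrite -big_split.
  by apply: eq_bigr => l _; rewrite mulrDr.
exact: addr_ge0.
Qed.

Lemma psd_kernel_spectral K : psd_kernel K ->
  exists (s : 'I_k -> C) (U : 'I_k -> 'I_k -> C),
    (forall m, 0 <= s m) /\
    forall j l, K j l = \sum_m s m * (U m j * (U m l)^*).
Proof.
move=> [Kh K0]; pose A := \matrix_(j, l) K j l.
have /orthomx_spectralP AE : A \is normalmx.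
  apply/hermitian_normalmx/is_hermitianmxP; rewrite expr0 scale1r.
  by apply/matrixP => j l; rewrite !mxE Kh.
set W := spectralmx A in AE; set D := spectral_diag A in AE.
have Wu : W \is unitarymx by exact: spectral_unitarymx.
exists (fun m => D 0 m), (fun m j => (W m j)^*); split=> [m|j l].
  (* The eigenvalue s m is the value of the form at the m-th eigenvector. *)
  have DE : diag_mx D = W *m A *m (W ^t Num.conj)%sesqui.
    rewrite AE -(invmx_unitary Wu) !mulmxA mulmxV ?unitarymx_unit// mul1mx.
    by rewrite -mulmxA mulmxV ?unitarymx_unit// mulmx1.
  have := K0 (fun j => W m j).
  congr (0 <= _); have /matrixP/(_ m m) := DE.
  rewrite !mxE eqxx mulr1n => ->; rewrite exchange_big/=.
  apply: eq_bigr => l _; rewrite !mxE mulr_suml; apply: eq_bigr => j _.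
  by rewrite !mxE mulrAC.
have /matrixP/(_ j l) := AE; rewrite mxE => ->.
rewrite (invmx_unitary Wu) mxE; apply: eq_bigr => m _.
by rewrite mul_mx_diag !mxE conjCK -mulrA mulrCA.
Qed.

(** Schur product theorem: diagonalizing [K] writes the form of the product as a
    nonnegative combination of values of the form of [L], at the vectors
    [c_j U_mj]. *)
Lemma psd_kernelM K L : psd_kernel K -> psd_kernel L ->
  psd_kernel (fun j l => K j l * L j l).
Proof.
move=> psdK [Lh L0]; have [Kh _] := psdK.
split=> [j l|c]; first by rewrite Kh Lh rmorphM.
have [s [U [s0 KE]]] := psd_kernel_spectral _ psdK.
have -> : \sum_j \sum_l c j * (c l)^* * (K j l * L j l) =
   \sum_m s m * \sum_j \sum_l (c j * U m j) * (c l * U m l)^* * L j l.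
  under [RHS]eq_bigr do rewrite mulr_sumr.
  rewrite [RHS]exchange_big/=; apply: eq_bigr => j _.
  under [RHS]eq_bigr do rewrite mulr_sumr.
  rewrite [RHS]exchange_big/=; apply: eq_bigr => l _.
  rewrite KE mulr_suml mulr_sumr; apply: eq_bigr => m _.
  rewrite rmorphM; ring.
by apply: sumr_ge0 => m _; rewrite mulr_ge0.
Qed.

Lemma psd_kernel1 : psd_kernel (fun _ _ : 'I_k => 1 : C).
Proof.
split=> [j l|c]; first by rewrite conjC1.
have -> : \sum_j \sum_l c j * (c l)^* * 1 = `|\sum_j c j| ^+ 2.
  rewrite normCK rmorph_sum big_distrlr/=; apply: eq_bigr => j _.
  by apply: eq_bigr => l _; rewrite mulr1.
by rewrite exprn_ge0.
Qed.

(** The kernels [P i] and [Q i] are exchanged one at a time, since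
    [p p' - q q' = (p - q) p' + q (p' - q')]. *)
Lemma psd_kernel_prod_le {I : finType} (P Q : I -> 'I_k -> 'I_k -> C) :
    (forall i, psd_kernel (Q i)) ->
    (forall i, psd_kernel (fun j l => P i j l - Q i j l)) ->
  psd_kernel (fun j l => \prod_i P i j l - \prod_i Q i j l).
Proof.
move=> Q0 PQ0.
(* The induction also needs the products of the Q i to be positive. *)
have [] // : psd_kernel (fun j l => \prod_i Q i j l) /\
  psd_kernel (fun j l => \prod_i P i j l - \prod_i Q i j l).
elim: (index_enum I) => [|i s [IHQ IHPQ]].
  split.
    rewrite (_ : (fun _ _ => _) = fun _ _ => 1); first exact: psd_kernel1.
    by apply/funext => j; apply/funext => l; rewrite big_nil.
  split=> [j l|c]; first by rewrite !big_nil subrr conjC0.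
  by rewrite big1// => j _; rewrite big1// => l _; rewrite !big_nil subrr mulr0.
split.
  rewrite (_ : (fun _ _ => _) = fun j l => Q i j l * \prod_(i <- s) Q i j l).
    exact: psd_kernelM.
  by apply/funext => j; apply/funext => l; rewrite big_cons.
rewrite (_ : (fun _ _ => _) = fun j l =>
    (P i j l - Q i j l) *
      ((\prod_(i <- s) P i j l - \prod_(i <- s) Q i j l) +
       \prod_(i <- s) Q i j l) +
    Q i j l * (\prod_(i <- s) P i j l - \prod_(i <- s) Q i j l)).
  apply: psd_kernelD; apply: psd_kernelM => //.
  exact: psd_kernelD.
by apply/funext => j; apply/funext => l; rewrite !big_cons; ring.
Qed.

End PsdKernels.

(** * Gram kernels and tensor products of contractions *)

Section GramKernels.
Context {R : realType} {V : hilbertType R}.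

Lemma inner_conj (u v : V) : inner u v = (inner v u)^*.
Proof. by rewrite hermC expr0 mul1r. Qed.

Lemma inner_sum_norm k (c : 'I_k -> R[i]) (x : 'I_k -> V) :
  `|\sum_j c j *: x j| ^+ 2 = \sum_j \sum_l c j * (c l)^* * inner (x j) (x l).
Proof.
rewrite inner_normE linear_sumlz; apply: eq_bigr => j _.
rewrite linear_sumr; apply: eq_bigr => l _.
by rewrite linearZl_LR/= linearZr_LR/= mulrA.
Qed.

Lemma psd_gram k (x : 'I_k -> V) : psd_kernel (fun j l => inner (x j) (x l)).
Proof.
split=> [j l|c]; first exact: inner_conj.
by rewrite -inner_sum_norm exprn_ge0.
Qed.

(** The form of this kernel at [c] is [|z|^2 - |T z|^2] for
    [z = \sum_j c_j x_j]. *)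
Lemma psd_gram_contraction k (x : 'I_k -> V) (T : bop V) :
  bop_contraction T ->
  psd_kernel (fun j l => inner (x j) (x l) - inner (T (x j)) (T (x l))).
Proof.
move=> T1; split=> [j l|c].
  by rewrite rmorphB/= -!inner_conj.
have -> : \sum_j \sum_l c j * (c l)^* *
      (inner (x j) (x l) - inner (T (x j)) (T (x l))) =
    `|\sum_j c j *: x j| ^+ 2 - `|T (\sum_j c j *: x j)| ^+ 2.
  rewrite linear_sum; under [X in _ - `|X| ^+ 2]eq_bigr do rewrite linearZ.
  rewrite !inner_sum_norm -sumrB; apply: eq_bigr => j _.
  by rewrite -sumrB; apply: eq_bigr => l _; rewrite mulrBr.
by rewrite subr_ge0 ler_sqr ?nnegrE// contraction_le.
Qed.

(** Cauchy-Schwarz against a unit vector: the defect is the squared norm of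
    the component of [u] orthogonal to [v]. *)
Lemma norm_inner_unit (u v : V) : `|v| = 1 -> `|inner u v| <= `|u|.
Proof.
move=> v1; rewrite -ler_sqr ?nnegrE// -subr_ge0.
have vv : inner v v = 1 by rewrite -inner_normE v1 expr1n.
have -> : `|u| ^+ 2 - `|inner u v| ^+ 2 = `|u - inner u v *: v| ^+ 2.
  rewrite !inner_normE normCK linearBl/= !linearB/=.
  rewrite !linearZl_LR/= !linearZr_LR/=.
  by rewrite vv -(inner_conj v u); ring.
by rewrite exprn_ge0.
Qed.

End GramKernels.

Section TensorContraction.
Context {R : realType} {n : nat} {H : 'I_n -> hilbertType R}.
Variables (HT : hilbert_tensor H) (T : forall i, bop (H i)).
Hypothesis T_contraction : forall i, bop_contraction (T i).

Lemma tensor_sum_contraction k (c : 'I_k -> R[i]) (x : 'I_k -> forall i, H i) :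
  `|\sum_j c j *: tensor HT (fun i => T i (x j i))| <=
  `|\sum_j c j *: tensor HT (x j)|.
Proof.
rewrite -ler_sqr ?nnegrE// -subr_ge0 !inner_sum_norm.
have [_ /(_ c)] := psd_kernel_prod_le
  (fun i j l => inner (x j i) (x l i))
  (fun i j l => inner (T i (x j i)) (T i (x l i)))
  (fun i => psd_gram _ (fun j => T i (x j i)))
  (fun i => psd_gram_contraction _ (fun j => x j i) _ (T_contraction i)).
congr (0 <= _); rewrite -sumrB; apply: eq_bigr => j _.
rewrite -sumrB; apply: eq_bigr => l _.
by rewrite !tensor_inner mulrBr.
Qed.

(** The relation sending [\sum_j c_j x_j] to [\sum_j c_j (T x_j)] on finite
    combinations of elementary tensors is contractive by
    [tensor_sum_contraction]; the operator is its extension. *)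
Lemma tensor_op_contraction :
  is_tensor_op T (tensor_op HT T) /\ bop_contraction (tensor_op HT T).
Proof.
have [||||S [SG S1]] := @bounded_extension R HT (fun z w =>
   exists k (c : 'I_k -> R[i]) (x : 'I_k -> forall i, H i),
   z = \sum_j c j *: tensor HT (x j) /\
   w = \sum_j c j *: tensor HT (fun i => T i (x j i))) 1.
- move=> a z w z' w' [k [c [x [-> ->]]]] [k' [c' [x' [-> ->]]]].
  exists (k + k')%N, (fun j : 'I_(k + k') =>
      match fintype.split j with inl j => a * c j | inr j => c' j end),
    (fun j : 'I_(k + k') =>
      match fintype.split j with inl j => x j | inr j => x' j end).
  by rewrite !big_split_ord !scaler_sumr; split; congr (_ + _);
    apply: eq_bigr => j _;
    rewrite ?(unsplitK (inl j)) ?(unsplitK (inr j)) ?scalerA.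
- by [].
- move=> z w [k [c [x [-> ->]]]].
  by rewrite mul1r; exact: tensor_sum_contraction.
- move=> z e e0.
  have [||w [zw [k [c [x wE]]]]] := tensor_total (h := HT) (O := ball z e).
  + by exists z; exact: ballxx.
  + exact: ball_open.
  exists w, (\sum_j c j *: tensor HT (fun i => T i (x j i))).
  by split; [exists k, c, x | move: zw; rewrite -ball_normE].
have ST : is_tensor_op T S.
  move=> x; apply: SG; exists 1%N, (fun=> 1), (fun=> x).
  by rewrite !big_ord1 !scale1r.
have -> : tensor_op HT T = S.
  apply: (is_tensor_op_unique _ ST).
  by apply: (@xgetPex _ 0 [set S | is_tensor_op T S]); exists S.
split=> //; rewrite /bop_contraction bop_normE.
by rewrite -(rmorph1 (real_complex R)) lecR opnorm_le.
Qed.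

End TensorContraction.

(** * Phases and products *)

Lemma dist_prod_le {K : numDomainType} {I : Type} (s : seq I) (P : pred I)
    (u v : I -> K) :
    (forall i, `|u i| <= 1) -> (forall i, `|v i| <= 1) ->
  `|\prod_(i <- s | P i) u i - \prod_(i <- s | P i) v i| <=
    \sum_(i <- s | P i) `|u i - v i|.
Proof.
move=> u1 v1.
have [] // : `|\prod_(i <- s | P i) v i| <= 1 /\
  `|\prod_(i <- s | P i) u i - \prod_(i <- s | P i) v i| <=
    \sum_(i <- s | P i) `|u i - v i|.
elim/big_rec3: _ => [|i e q p Pi [p1 IH]]; first by rewrite subrr normr0 normr1.
split; first by rewrite normrM mulr_ile1.
have -> : u i * q - v i * p = (u i - v i) * p + u i * (q - p) by ring.
rewrite (le_trans (ler_normD _ _))// !normrM lerD//.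
  by rewrite ler_piMr.
by rewrite (le_trans _ IH)// ler_piMl.
Qed.

Lemma phase_exists {C : numClosedFieldType} (a : C) :
  exists w, `|w| = 1 /\ a * w = `|a|.
Proof.
have [->|a0] := eqVneq a 0; first by exists 1; rewrite normr1 mul0r normr0.
exists (`|a| / a); split; last by rewrite mulrC divfK.
by rewrite normrM normfV normr_id mulfV ?normr_eq0.
Qed.

(** The partial products are prescribed, so the [l j] are the successive ratios
    of these prescribed values. *)
Lemma cumulative_phases {C : numClosedFieldType} {n : nat} (a : 'I_n -> C) :
  exists l : 'I_n -> C, (forall i, `|l i| = 1) /\
    forall i, a i * \prod_(j < n | (j <= i)%N) l j = `|a i|.
Proof.
have [w wP] := choice (fun i => phase_exists (a i)).
(* W m is the product of the first m phases, starting from W 0 = 1; the value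
   past n only serves to make W total. *)
pose W m := if m is m'.+1 then if insub m' is Some i then w i else 1 else 1.
have W1 m : `|W m| = 1.
  case: m => [|m]; rewrite /= ?normr1//.
  by case: insubP => [i _ _|_]; rewrite ?normr1// (wP i).1.
exists (fun j => W j.+1 / W j); split=> [i|i].
  by rewrite normrM normfV !W1 invr1 mulr1.
have -> : \prod_(j < n | (j <= i)%N) (W j.+1 / W j) = W i.+1.
  rewrite (eq_bigl (fun j : 'I_n => (j < i.+1)%N))//.
  rewrite -(big_ord_widen n (fun j => W j.+1 / W j))//.
  rewrite -(big_mkord xpredT (fun j => W j.+1 / W j)).
  rewrite telescope_prodf// ?divr1// => m _.
  by rewrite -normr_eq0 W1 oner_eq0.
rewrite /= valK; exact: (wP i).2.
Qed.

(** * Norm bounds *)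

Lemma bop_id_contraction {R : realType} {V : normedModType R[i]} :
  bop_contraction (@bop_id R V).
Proof.
rewrite /bop_contraction bop_normE -(rmorph1 (real_complex R)) lecR.
by rewrite opnorm_le// => x; rewrite rmorph1 mul1r.
Qed.

Lemma bop_sumE {R : realType} {V : normedModType R[i]} {I : finType}
    (f : I -> R[i]) (S : I -> bop V) x :
  (\sum_i f i *: S i) x = \sum_i f i *: S i x.
Proof. by elim/big_rec2: _ => // i y1 y2 _ <-. Qed.

Section Isometry.
Context {R : realType} {n : nat} {H : 'I_n -> hilbertType R}.
Variables (HT : hilbert_tensor H) (T : forall i, bop (H i)).
Hypothesis T_contraction : forall i, bop_contraction (T i).

Lemma tensor_tildeP (i : 'I_n) :
  is_tensor_op (fun j => if (j <= i)%N then T j else bop_id)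
    (tensor_tilde HT T i)
  /\ bop_contraction (tensor_tilde HT T i).
Proof.
apply: tensor_op_contraction => j; case: ifP => // _.
exact: bop_id_contraction.
Qed.

Lemma g_opB a b : g_op HT T a - g_op HT T b = g_op HT T (a - b).
Proof.
rewrite /g_op -sumrB; apply: eq_bigr => i _.
by rewrite -scalerBl !mxE.
Qed.

Lemma g_op_le (a : l1 R n) : `|g_op HT T a| <= `|a|.
Proof.
rewrite l1_normE (le_trans (ler_norm_sum _ _ _))// ler_sum// => i _.
by rewrite normrZ ler_piMr// (tensor_tildeP i).2.
Qed.

Hypothesis T_spectrum : forall i, [set l : R[i] | `|l| = 1] `<=` spectrum (T i).

(** The norm is tested on [<g(a) X, X>] rather than on [g(a) X], because inner
    products of elementary tensors are products of numbers, which [dist_prod_le]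
    compares factor by factor. *)
Lemma g_op_ge (a : l1 R n) : `|a| <= `|g_op HT T a|.
Proof.
have [l [l_unit al]] := cumulative_phases (fun i => (a : 'rV_n) 0 i).
apply/ler_addgt0Pr => e e0.
(* An error d in each factor costs at most n d in each partial product, hence
   |a| n d in total; the added 1 keeps the denominator of d nonzero. *)
have K0 : 0 < `|a| * n%:R + 1 by rewrite ltr_wpDl// mulr_ge0.
have d0 : 0 < e / (`|a| * n%:R + 1) by rewrite divr_gt0.
set d := e / _ in d0.
have [x xP] : exists x : forall i, H i, forall i,
    `|x i| = 1 /\ `|T i (x i) - l i *: x i| < d.
  have xex i := approximate_eigenvector _ _ (T_contraction i) (l_unit i) _ d0
    (T_spectrum i _ (l_unit i)).
  exists (fun i => projT1 (cid (xex i))) => i; exact: projT2 (cid (xex i)).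
have xx i : inner (x i) (x i) = 1 by rewrite -inner_normE (xP i).1 expr1n.
pose X := tensor HT x.
have X1 : `|X| = 1.
  apply/eqP; rewrite -(@eqrXn2 _ 2)// expr1n inner_normE tensor_inner.
  by rewrite big1.
pose t i := inner (T i (x i)) (x i).
have t1 i : `|t i| <= 1.
  rewrite (le_trans (norm_inner_unit _ _ (xP i).1))//.
  by rewrite (le_trans (contraction_le _ _ (T_contraction i)))// (xP i).1.
have tl i : `|t i - l i| <= d.
  have -> : t i - l i = inner (T i (x i) - l i *: x i) (x i).
    by rewrite linearBl/= linearZl_LR/= xx mulr1.
  by rewrite (le_trans (norm_inner_unit _ _ (xP i).1))// ltW// (xP i).2.
have gX : inner (g_op HT T a X) X =
    \sum_i (a : 'rV_n) 0 i * \prod_(j < n | (j <= i)%N) t j.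
  rewrite /g_op bop_sumE linear_sumlz; apply: eq_bigr => i _.
  rewrite linearZl_LR/= (tensor_tildeP i).1 tensor_inner; congr (_ * _).
  rewrite [RHS]big_mkcond; apply: eq_bigr => j _.
  by case: ifP.
have aE : `|a| = inner (g_op HT T a X) X + \sum_i (a : 'rV_n) 0 i *
   (\prod_(j < n | (j <= i)%N) l j - \prod_(j < n | (j <= i)%N) t j).
  rewrite gX -big_split l1_normE; apply: eq_bigr => i _.
  by rewrite /= -mulrDr addrC subrK al.
rewrite -[leLHS]normr_id aE (le_trans (ler_normD _ _))// lerD//.
  rewrite (le_trans (norm_inner_unit _ _ X1))//.
  by rewrite (le_trans (opnorm_ub _ _))// X1 mulr1.
have -> : e = d + `|a| * (n%:R * d).
  by rewrite mulrA -[LHS](divfK (lt0r_neq0 K0)) mulrDr mulr1 addrC (mulrC _ d).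
rewrite ler_wpDl ?(ltW d0)// l1_normE mulr_suml.
rewrite (le_trans (ler_norm_sum _ _ _))//.
apply: ler_sum => i _; rewrite normrM ler_wpM2l//.
rewrite (le_trans (dist_prod_le _ _ _ _ _ _))// => [j|].
  by rewrite l_unit.
rewrite (@le_trans _ _ (\sum_(j < n) d))//; last first.
  by rewrite sumr_const card_ord mulr_natl.
rewrite [leLHS]big_mkcond; apply: ler_sum => j _.
case: ifP => _; last exact: ltW.
by rewrite distrC tl.
Qed.

End Isometry.

Theorem theorem3p2 (R : realType) (n : nat) (n_ge1 : (1 <= n)%N)
  (H : 'I_n -> hilbertType R) (T : forall i : 'I_n, bop (H i))
  (T_contraction : forall i, bop_contraction (T i))
  (T_spectrum : forall i, [set l : R[i] | `|l| = 1] `<=` spectrum (T i))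
  (HT : hilbert_tensor H) :
  is_isometry (g_op HT T).
Proof.
by move=> a b; rewrite g_opB; apply/le_anti; rewrite g_op_le// g_op_ge.
Qed.
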